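(* Let $\alpha,\beta,\gamma\in{}^*\mathbb N$. If $\alpha\sim\beta\sim\gamma$ and $(\alpha,\beta)$ is a Ramsey pair, then $\alpha,\beta,\gamma$ do not form, in any order, an arithmetic progression (of length $3$).
   Context: $\mathbb N$ is the set of positive integers. ${}^*\mathbb N$ is a fixed $\mathfrak c^+$-saturated elementary extension (nonstandard extension) of $\mathbb N$ equipped with its full first-order structure (a symbol for every subset of every $\mathbb N^k$); ${}^*A$ is the nonstandard extension of $A\subseteq\mathbb N^k$. For $\alpha\in{}^*\mathbb N^k$, $\mathfrak u(\alpha)=\{A\subseteq\mathbb N^k\mid\alpha\in{}^*A\}\in\beta\mathbb N^k$ (the space of ultrafilters on $\mathbb N^k$), and $\alpha\sim\alpha'$ means $\mathfrak u(\alpha)=\mathfrak u(\alpha')$. For $H\subseteq\mathbb N$, $[H]^2=\{(h_1,h_2)\in H^2\mid h_1<h_2\}$. An ultrafilter $u$ on $\mathbb N^2$ is a Ramsey's witness, $u\in\mathrm{RW}$, if for every $A\in u$ there is an infinite $H\subseteq\mathbb N$ with $[H]^2\subseteq A$. A pair $(\alpha,\beta)\in{}^*\mathbb N^2$ is a Ramsey pair if $\mathfrak u(\alpha,\beta)\in\mathrm{RW}$. That $x,y,z$ form, in some order, an arithmetic progression of length $3$ means $(x+y=2z)\vee(x+z=2y)\vee(y+z=2x)$. *)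

(* Defs.v *)
From Stdlib Require Import PArith.
From mathcomp Require Import all_boot.
From mathcomp Require Import mathcomp_extra boolp classical_sets functions.
From mathcomp Require Import cardinality filter.

Set Implicit Arguments.
Unset Strict Implicit.
Unset Printing Implicit Defensive.

Local Open Scope classical_set_scope.
Local Open Scope card_scope.

(* [positive], the type of positive integers, plays the role of the set of
   natural numbers (without 0). *)

(* First-order formulas with free variables among ['I_n], in the relational
   language with one k-ary symbol for every set of k-tuples of positive
   integers.  A quantifier binds variable [ord0] of its body; the remaining
   variables are shifted by one. *)
Inductive formula : nat -> Type :=
| FEq n (i j : 'I_n) : formula n
| FRel n k (A : set (k.-tuple positive)) (v : k.-tuple 'I_n) : formula n
| FNot n (phi : formula n) : formula n
| FAnd n (phi psi : formula n) : formula n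
| FOr n (phi psi : formula n) : formula n
| FImp n (phi psi : formula n) : formula n
| FAll n (phi : formula n.+1) : formula n
| FEx n (phi : formula n.+1) : formula n.

Record structure := Structure {
  carrier :> Type;
  interp : forall k, set (k.-tuple positive) -> set (k.-tuple carrier)
}.

Definition full_structure : structure :=
  @Structure positive (fun k (A : set (k.-tuple positive)) => A).

Fixpoint sat (M : structure) n (phi : formula n) : n.-tuple M -> Prop :=
  match phi in formula n return n.-tuple M -> Prop with
  | FEq _ i j => fun e => tnth e i = tnth e j
  | FRel _ _ A v => fun e => interp A [tuple of map (tnth e) v]
  | FNot _ p => fun e => ~ sat p e
  | FAnd _ p q => fun e => sat p e /\ sat q e
  | FOr _ p q => fun e => sat p e \/ sat q e
  | FImp _ p q => fun e => sat p e -> sat q e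
  | FAll _ p => fun e => forall x : M, sat p [tuple of x :: e]
  | FEx _ p => fun e => exists x : M, sat p [tuple of x :: e]
  end.

Definition elementary (M : structure) (j : positive -> M) : Prop :=
  forall n (phi : formula n) (e : n.-tuple positive),
    @sat full_structure n phi e <-> sat phi [tuple of map j e].

(* A formula [phi(x, b_1, ..., b_m)] in one free variable [x] (which is
   variable [ord0] of [phi]) with parameters [b_i] in [M]. *)
Record pformula (M : structure) := PFormula {
  nparams : nat;
  pform : formula nparams.+1;
  params : nparams.-tuple M
}.

Definition psat (M : structure) (phi : pformula M) (x : M) : Prop :=
  sat (pform phi) [tuple of x :: params phi].

(* Saturation for the cardinal successor of the continuum: having fewer
   parameters than that successor means having at most continuum many. *)
Definition continuum_succ_saturated (M : structure) : Prop :=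
  forall (B : set M) (p : set (pformula M)),
    B #<= [set: set nat] ->
    (forall phi, p phi -> forall i, B (tnth (params phi) i)) ->
    (forall q : set (pformula M), finite_set q -> q `<=` p ->
       exists x : M, forall phi, q phi -> psat phi x) ->
    exists x : M, forall phi, p phi -> psat phi x.

Record nonstandard_extension := NonstandardExtension {
  nse_structure :> structure;
  std : positive -> nse_structure;
  std_elementary : elementary std;
  nse_saturated : continuum_succ_saturated nse_structure
}.

Definition star (S : nonstandard_extension) k (A : set (k.-tuple positive)) :
  set (k.-tuple S) := interp A.

Definition ultra_of (S : nonstandard_extension) k (x : k.-tuple S) :
  set_system (k.-tuple positive) := [set A | star A x].

Definition equivalent (S : nonstandard_extension) k (x y : k.-tuple S) : Prop :=
  ultra_of x = ultra_of y.

Definition increasing_pairs (H : set positive) : set (2.-tuple positive) :=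
  [set t | exists x y, [/\ t = [tuple x; y], H x, H y & Pos.lt x y]].

Definition Ramsey_witness (u : set_system (2.-tuple positive)) : Prop :=
  UltraFilter u /\
  forall A, u A ->
    exists H : set positive, infinite_set H /\ increasing_pairs H `<=` A.

Definition Ramsey_pair (S : nonstandard_extension) (a b : S) : Prop :=
  Ramsey_witness (ultra_of [tuple a; b]).

Definition graph2 (f : positive -> positive -> positive) :
  set (3.-tuple positive) := [set t | exists x y, t = [tuple x; y; f x y]].

Lemma star_val (S : nonstandard_extension) k (A : set (k.-tuple positive))
  (x y : k.-tuple S) : val x = val y -> star A x -> star A y.
Proof. by move=> /val_inj ->. Qed.

Lemma star_graph2_total (S : nonstandard_extension)
    (f : positive -> positive -> positive) (a b : S) :
  exists c : S, star (graph2 f) [tuple a; b; c].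
Proof.
pose v2 : 'I_3 := @Ordinal 3 2 isT.
pose v1 : 'I_3 := @Ordinal 3 1 isT.
pose v0 : 'I_3 := @Ordinal 3 0 isT.
pose phi := FAll (FAll (FEx (FRel (graph2 f) [tuple v2; v1; v0]))).
have /(std_elementary S phi [tuple]) /= H : @sat full_structure 0 phi [tuple].
  move=> x y /=; exists (f x y), x, y.
  by apply/val_inj; rewrite /= !(tnth_nth x).
have [c Hc] := H a b; exists c.
by apply: star_val Hc.
Qed.

(* The nonstandard extension of a binary operation: the operation whose graph
   is the nonstandard extension of its graph. *)
Definition star_op (S : nonstandard_extension)
    (f : positive -> positive -> positive) (a b : S) : S :=
  sval (cid (star_graph2_total f a b)).

Lemma star_opP (S : nonstandard_extension)
    (f : positive -> positive -> positive) (a b c : S) :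
  star (graph2 f) [tuple a; b; c] <-> c = star_op f a b.
Proof.
have Hop : star (graph2 f) [tuple a; b; star_op f a b].
  exact: (svalP (cid (star_graph2_total f a b))).
split=> [Hc|-> //].
pose v3 : 'I_4 := @Ordinal 4 3 isT.
pose v2 : 'I_4 := @Ordinal 4 2 isT.
pose v1 : 'I_4 := @Ordinal 4 1 isT.
pose v0 : 'I_4 := @Ordinal 4 0 isT.
pose phi := FAll (FAll (FAll (FAll (FImp
  (FRel (graph2 f) [tuple v3; v2; v1])
  (FImp (FRel (graph2 f) [tuple v3; v2; v0]) (FEq v1 v0)))))).
have /(std_elementary S phi [tuple]) /= H : @sat full_structure 0 phi [tuple].
  move=> x y z t /= [x1 [y1 /(congr1 val) /=]].
  rewrite /tnth /= => -[-> -> ->] [x2 [y2 /(congr1 val) /=]].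
  by rewrite /tnth /= => -[-> -> ->].
have := H a b c (star_op f a b); rewrite /tnth /=; apply.
- by apply: star_val Hc.
- by apply: star_val Hop.
Qed.

Definition star_add (S : nonstandard_extension) : S -> S -> S := star_op Pos.add.

Definition star_mul (S : nonstandard_extension) : S -> S -> S := star_op Pos.mul.

Definition arith_prog3 (S : nonstandard_extension) (x y z : S) : Prop :=
  [\/ star_add x y = star_mul (std S 2%positive) z,
      star_add x z = star_mul (std S 2%positive) y |
      star_add y z = star_mul (std S 2%positive) x].

(* Main.v *)
Require Import Defs.
From mathcomp Require Import all_boot.
From Stdlib Require Import ZArith Lia.
From mathcomp Require Import classical_sets cardinality filter.

(** In a Ramsey pair [(alpha, beta)] one has [4 alpha <= beta], because an
    infinite set cannot have all its pairs below the graph of a function.  This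
    excludes [beta + gamma = 2 alpha].  In the other two cases
    [alpha + y = 2 x] with [{x, y} = {beta, gamma}], so that [y] is only
    slightly smaller than [2 x].  If [x] and [y] have binary logarithms of the
    same parity, then these logarithms are equal, say to [n]; hence [x] is only
    slightly larger than [2^n] and [y] only slightly smaller than [2^(n+1)],
    and the second highest binary digits of [x] and [y] differ.  So [x] and [y]
    do not generate the same ultrafilter. *)

Set Implicit Arguments.
Unset Strict Implicit.
Unset Printing Implicit Defensive.

Local Open Scope classical_set_scope.

Definition even_log2 : set (1.-tuple positive) :=
  [set t | Z.even (Z.log2 (Zpos (tnth t ord0)))].

(** With [n] the binary logarithm of [x], this is [x >= 2^n + 2^(n-1)], doubled so that [n = 0] is
    no exception. *)
Definition second_digit_one : set (1.-tuple positive) :=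
  [set t | let x := Zpos (tnth t ord0) in (3 * 2 ^ Z.log2 x <= 2 * x)%Z].

Definition four_times_le : set (2.-tuple positive) :=
  [set t | (4 * tnth t ord0 <= tnth t ord_max)%positive].

Definition singleton2 : set (1.-tuple positive) :=
  [set t | tnth t ord0 = 2%positive].

Lemma midpoint_separated (a x y : positive) :
  (4 * a <= x \/ 4 * a <= y)%positive -> (a + y = 2 * x)%positive ->
  (even_log2 [tuple x] <-> even_log2 [tuple y]) ->
  ~ (second_digit_one [tuple x] <-> second_digit_one [tuple y]).
Proof.
move=> far mid.
change ((Z.even (Z.log2 (Zpos x)) <-> Z.even (Z.log2 (Zpos y))) ->
  ~ ((3 * 2 ^ Z.log2 (Zpos x) <= 2 * Zpos x)%Z <->
     (3 * 2 ^ Z.log2 (Zpos y) <= 2 * Zpos y)%Z)) => parity digit.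
have [xlo xhi] := Z.log2_spec (Zpos x) ltac:(lia).
have [ylo yhi] := Z.log2_spec (Zpos y) ltac:(lia).
(* Either case of [far] gives [a <= x], hence [x <= y < 2 * x]. *)
have lexy : (Z.log2 (Zpos x) <= Z.log2 (Zpos y))%Z by apply: Z.log2_le_mono; lia.
have leyx : (Z.log2 (Zpos y) <= Z.succ (Z.log2 (Zpos x)))%Z.
  rewrite -Z.log2_double; last by lia.
  by apply: Z.log2_le_mono; lia.
have eqxy : Z.log2 (Zpos y) = Z.log2 (Zpos x).
  have [//|eqS] : Z.log2 (Zpos y) = Z.log2 (Zpos x) \/
                  Z.log2 (Zpos y) = Z.succ (Z.log2 (Zpos x)) by lia.
  move: parity; rewrite eqS Z.even_succ -Z.negb_even.
  by case: Z.even => -[p q]; [have := p isT | have := q isT].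
(* With [n] the common logarithm, [4 * a < 2^(n+1)]. So [2 * x = a + y < 3 * 2^n], whereas
   [2 * y = 4 * x - 2 * a > 3 * 2^n]. *)
move: digit xlo xhi ylo yhi; rewrite eqxy Z.pow_succ_r; last exact: Z.log2_nonneg.
by lia.
Qed.

Lemma finite_pos_le (m : positive) : finite_set [set x | (x <= m)%positive].
Proof.
apply: (@sub_finite_set _ _ (Pos.of_nat @` `I_(Pos.to_nat m).+1)).
  move=> x /= le_xm; exists (Pos.to_nat x); last exact: Pos2Nat.id.
  by apply/ltP; lia.
exact/finite_image/finite_II.
Qed.

Lemma Ramsey_witness_above_graph (u : set_system (2.-tuple positive))
    (f : positive -> positive) :
  Ramsey_witness u ->
  u [set t | (f (tnth t ord0) <= tnth t ord_max)%positive].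
Proof.
move=> [uU uR]; set A := (X in u X).
have [//|/uR [H [Hinf HA]]] := in_ultra_setVsetC A uU.
have [h Hh] : H !=set0 by apply: infinite_setN0.
(* An element of [H] above the fixed [h] forms a pair with it, so it lies below [f h]. *)
exfalso; apply: Hinf; apply: sub_finite_set (finite_pos_le (Pos.max h (f h))).
move=> y Hy /=; have [lt_hy|] : (h < y \/ y <= h)%positive by lia.
  have /= : (~` A) [tuple h; y] by apply: HA; exists h, y.
  by rewrite /A /tnth /=; lia.
by lia.
Qed.

Lemma star_std2 (S : nonstandard_extension) :
  star singleton2 [tuple std S 2%positive].
Proof.
have /(std_elementary S (FRel singleton2 [tuple ord0]) [tuple 2%positive]) /= :
  @sat full_structure 1 (FRel singleton2 [tuple ord0]) [tuple 2%positive] by [].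
exact: star_val.
Qed.

Lemma graph2E f (x y z : positive) : graph2 f [tuple x; y; z] <-> z = f x y.
Proof.
split=> [[x1 [y1 /(congr1 val) /= [-> -> ->]]] //|->].
by exists x, y.
Qed.

Lemma equivalent_star (S : nonstandard_extension) k (x y : k.-tuple S) A :
  equivalent x y -> star A x <-> star A y.
Proof. by move=> /(congr1 (@^~ A)); rewrite /ultra_of /= => ->. Qed.

Lemma map_tuple1 (T U : Type) (f : T -> U) x :
  [tuple of map f [tuple x]] = [tuple f x].
Proof. exact/val_inj. Qed.

Lemma map_tuple2 (T U : Type) (f : T -> U) x y :
  [tuple of map f [tuple x; y]] = [tuple f x; f y].
Proof. exact/val_inj. Qed.

Lemma map_tuple3 (T U : Type) (f : T -> U) x y z :
  [tuple of map f [tuple x; y; z]] = [tuple f x; f y; f z].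
Proof. exact/val_inj. Qed.

Lemma star_midpoint_not_equivalent (S : nonstandard_extension) (a x y : S) :
  star four_times_le [tuple a; x] \/ star four_times_le [tuple a; y] ->
  star_add a y = star_mul (std S 2%positive) x ->
  ~ equivalent [tuple x] [tuple y].
Proof.
move=> far /star_opP mid eqv.
pose t5 : 'I_5 := @Ordinal 5 4 isT.
pose a5 : 'I_5 := @Ordinal 5 3 isT.
pose x5 : 'I_5 := @Ordinal 5 2 isT.
pose y5 : 'I_5 := @Ordinal 5 1 isT.
pose d5 : 'I_5 := @Ordinal 5 0 isT.
pose iff C := FAnd (FImp (FRel C [tuple x5]) (FRel C [tuple y5]))
                   (FImp (FRel C [tuple y5]) (FRel C [tuple x5])).
(* The language is purely relational: [t5] stands for 2, and [d5] for the common value of [a + y]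
   and [2 * x]. *)
pose phi := FAll (FAll (FAll (FAll (FAll (
  FImp (FRel singleton2 [tuple t5])
  (FImp (FOr (FRel four_times_le [tuple a5; x5])
             (FRel four_times_le [tuple a5; y5]))
  (FImp (FRel (graph2 Pos.add) [tuple a5; y5; d5])
  (FImp (FRel (graph2 Pos.mul) [tuple t5; x5; d5])
  (FImp (iff even_log2) (FNot (iff second_digit_one))))))))))).
have /(std_elementary S phi [tuple]) /= H : @sat full_structure 0 phi [tuple].
  move=> t b u v d /=; rewrite !(map_tuple1, map_tuple2, map_tuple3) /tnth /=.
  move=> two; have {two}-> : t = 2%positive := two.
  move=> bfar /graph2E -> /graph2E bmid parity digit.
  exact: (midpoint_separated bfar bmid parity digit).
have := H (std S 2%positive) a x y (star_add a y).
rewrite !(map_tuple1, map_tuple2, map_tuple3) /tnth /=; apply.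
- exact: star_std2.
- exact: far.
- exact/star_opP.
- exact: mid.
(* Equivalence supplies both the equal parities and the equal second digits, which the transferred
   sentence forbids together. *)
- exact: (equivalent_star _ eqv).
- exact: (equivalent_star _ eqv).
Qed.

(** Transfers [x + y > x >= 4 * a > 2 * a]. *)
Lemma star_add_neq_double (S : nonstandard_extension) (a x y : S) :
  star four_times_le [tuple a; x] ->
  star_add x y <> star_mul (std S 2%positive) a.
Proof.
move=> far /star_opP sum.
pose t5 : 'I_5 := @Ordinal 5 4 isT.
pose a5 : 'I_5 := @Ordinal 5 3 isT.
pose x5 : 'I_5 := @Ordinal 5 2 isT.
pose y5 : 'I_5 := @Ordinal 5 1 isT.
pose d5 : 'I_5 := @Ordinal 5 0 isT.
pose phi := FAll (FAll (FAll (FAll (FAll (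
  FImp (FRel singleton2 [tuple t5])
  (FImp (FRel four_times_le [tuple a5; x5])
  (FImp (FRel (graph2 Pos.add) [tuple x5; y5; d5])
  (FNot (FRel (graph2 Pos.mul) [tuple t5; a5; d5]))))))))).
have /(std_elementary S phi [tuple]) /= H : @sat full_structure 0 phi [tuple].
  move=> t b u v d /=; rewrite !(map_tuple1, map_tuple2, map_tuple3) /tnth /=.
  move=> two; have {two}-> : t = 2%positive := two.
  rewrite /four_times_le /tnth /= => bfar /graph2E -> /graph2E.
  by lia.
have := H (std S 2%positive) a x y (star_add x y).
rewrite !(map_tuple1, map_tuple2, map_tuple3) /tnth /=; apply.
- exact: star_std2.
- exact: far.
- exact/star_opP.
- exact: sum.
Qed.

Theorem theoremC (S : nonstandard_extension) (alpha beta gamma : S)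
  (hab : equivalent [tuple alpha] [tuple beta])
  (hbc : equivalent [tuple beta] [tuple gamma])
  (hR : Ramsey_pair alpha beta) :
  ~ arith_prog3 alpha beta gamma.
Proof.
have far : star four_times_le [tuple alpha; beta].
  exact: (Ramsey_witness_above_graph (Pos.mul 4) hR).
case=> [mid|mid|].
(* The midpoint is [gamma] here and [beta] in the next case; [far] bounds [alpha] by [beta] in
   both. *)
- by apply: star_midpoint_not_equivalent mid (esym hbc); right.
- by apply: star_midpoint_not_equivalent mid hbc; left.
- exact: star_add_neq_double far.
Qed.
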